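(* There is a fixed constant $c>0$ such that the following holds. Let $p\in(0,1)$, $q=1-p$, and let $D\sim\mathcal D_p$ be the scaled Bernoulli demand vector. For any bipartite graph $G$ with $n$ nodes in each partition and average degree $d$ (an integer with $0\le d<n$), the expected loss satisfies $$L(G)\ \ge\ \mathbb P\{\mathrm{Bin}(n-d,p)\ge np\}\cdot nq^{d}\ \ge\ \left(\frac12-\frac{dp}{\sqrt{2\pi(n-d)pq}}-\frac{c(1-2pq)}{\sqrt{(n-d)pq}}\right)nq^{d}.$$
   Context: A bipartite graph $G=([n],[n],E)$ has $n$ supply nodes (left) and $n$ demand nodes (right), $E\subseteq[n]\times[n]$; its average degree is $d=|E|/n$. For a demand vector $D\in\mathbb R_{\ge0}^n$ define the maximum fulfilled demand $$z(G,D)=\max_{x_{ij}\ge 0}\ \sum_{(i,j)\in E}x_{ij}\quad\text{s.t.}\quad \sum_{j:(i,j)\in E}x_{ij}\le 1\ \ (i\in[n]),\qquad \sum_{i:(i,j)\in E}x_{ij}\le D_j\ \ (j\in[n]).$$ Let $K_{n,n}$ be the complete bipartite graph, $L(G,D)=z(K_{n,n},D)-z(G,D)$, and $L(G)=\mathbb E_{D\sim\mathcal D_p}[L(G,D)]$. Under $\mathcal D_p$, the coordinates $D_j$ are independent, each equal to $1/p$ with probability $p$ and $0$ with probability $q=1-p$. $\mathrm{Bin}(m,p)$ denotes a binomial random variable. *)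

(* Defs.v *)
From HB Require Import structures.
From mathcomp Require Import all_boot all_order all_algebra.
From mathcomp Require Import all_classical all_reals all_analysis.

Set Implicit Arguments.
Unset Strict Implicit.
Unset Printing Implicit Defensive.

Import Order.TTheory GRing.Theory Num.Theory.
Import numFieldNormedType.Exports.

Local Open Scope classical_set_scope.
Local Open Scope ring_scope.

(* The first component of an edge is its supply node, the second one its
   demand node. *)
Definition bigraph (n : nat) := {set 'I_n * 'I_n}.

Definition complete_bigraph (n : nat) : bigraph n := [set: 'I_n * 'I_n]%SET.

Definition avg_degree (R : realType) (n : nat) (G : bigraph n) : R :=
  #|G|%:R / n%:R.

(* Only the entries of x indexed by edges of G are constrained, and only
   these contribute to flow_value. *)
Definition feasible_flow (R : realType) (n : nat) (G : bigraph n)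
    (D : 'I_n -> R) (x : 'I_n -> 'I_n -> R) : Prop :=
  [/\ forall i j, (i, j) \in G -> 0 <= x i j,
      forall i, \sum_(j | (i, j) \in G) x i j <= 1
    & forall j, \sum_(i | (i, j) \in G) x i j <= D j].

Definition flow_value (R : realType) (n : nat) (G : bigraph n)
    (x : 'I_n -> 'I_n -> R) : R :=
  \sum_(e in G) x e.1 e.2.

(* For D >= 0 the feasible values form a nonempty compact set, so that this
   supremum is the maximum of the linear program. *)
Definition max_fulfilled (R : realType) (n : nat) (G : bigraph n)
    (D : 'I_n -> R) : R :=
  sup [set flow_value G x | x in [set x | feasible_flow G D x]].

Definition loss (R : realType) (n : nat) (G : bigraph n) (D : 'I_n -> R) : R :=
  max_fulfilled (complete_bigraph n) D - max_fulfilled G D.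

Definition mutually_independent (dT : measure_display) (T : measurableType dT)
    (R : realType) (P : probability T R) (n : nat)
    (X : 'I_n -> {RV P >-> R}) : Prop :=
  forall (J : {set 'I_n}) (A : 'I_n -> set R),
    (forall j, measurable (A j)) ->
    P (\bigcap_(j in [set` J]) (X j @^-1` A j)) =
    (\prod_(j in J) P (X j @^-1` A j))%E.

Definition scaled_bernoulli (dT : measure_display) (T : measurableType dT)
    (R : realType) (P : probability T R) (n : nat) (p : R)
    (D : 'I_n -> {RV P >-> R}) : Prop :=
  [/\ mutually_independent D,
      forall j, P (D j @^-1` [set p^-1]) = p%:E
    & forall j, P (D j @^-1` [set 0]) = (1 - p)%:E].

Definition expected_loss (dT : measure_display) (T : measurableType dT)
    (R : realType) (P : probability T R) (n : nat) (D : 'I_n -> {RV P >-> R})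
    (G : bigraph n) : \bar R :=
  ('E_P[fun w => loss G (fun j => D j w)])%E.

(* Main.v *)
Require Import Defs.
From HB Require Import structures.
From mathcomp Require Import all_boot all_order all_algebra.
From mathcomp Require Import all_classical all_reals all_analysis.
From mathcomp Require Import measurable_realfun.
From mathcomp Require Import ring lra zify.

Set Implicit Arguments.
Unset Strict Implicit.
Unset Printing Implicit Defensive.

Import Order.TTheory GRing.Theory Num.Theory.
Import numFieldNormedType.Exports.

Local Open Scope classical_set_scope.
Local Open Scope ring_scope.

(** If total demand is at least [n], the loss is at least the number of supply
    nodes all of whose neighbours have zero demand.  Summing the probability of
    this event over supply nodes gives [\sum_i h d_i], where [d_i] is the degree
    of node [i] and [h x = q^x P(Bin(n-x,p) >= np)]; Pascal's rule makes [h]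
    discretely convex, so the sum is at least [n h d].

    For the second inequality no Berry-Esseen theorem is needed.  A binomial law
    has median at least the floor of its mean, so [P(Bin(m,p) >= np)] is at least
    [1/2] minus the mass of the at most [dp + 2] integers between [floor(mp)] and
    [np].  A local limit bound for one atom, with the sharp constant
    [1/sqrt(2 pi s^2)], [s^2 = mpq], and relative error [O(1/s)], then suffices:
    when [dp / s] is at least [sqrt (pi / 2)] the claimed bound is not positive. *)

(** * Stirling's formula and a local limit bound *)

Section is_derive_pointwise.
Context {R : realType}.
Implicit Types (f g : R -> R) (x a b : R).

Lemma is_derive1D f g x a b : is_derive x 1 f a -> is_derive x 1 g b ->
  is_derive x 1 (fun y => f y + g y) (a + b).
Proof. exact: is_deriveD. Qed.

Lemma is_derive1B f g x a b : is_derive x 1 f a -> is_derive x 1 g b ->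
  is_derive x 1 (fun y => f y - g y) (a - b).
Proof. exact: is_deriveB. Qed.

Lemma is_derive1M f g x a b : is_derive x 1 f a -> is_derive x 1 g b ->
  is_derive x 1 (fun y => f y * g y) (f x * b + g x * a).
Proof. exact: is_deriveM. Qed.

Lemma is_derive1Z k f x a : is_derive x 1 f a ->
  is_derive x 1 (fun y => k * f y) (k * a).
Proof. exact: is_deriveZ. Qed.

Lemma is_derive1X n f x a : is_derive x 1 f a ->
  is_derive x 1 (fun y => f y ^+ n) (n%:R * f x ^+ n.-1 * a).
Proof. by rewrite -[fun _ => _]/(fun y => f y ^+ n) -exprfctE; exact: is_deriveX. Qed.

Lemma is_derive1V f x a : f x != 0 -> is_derive x 1 f a ->
  is_derive x 1 (fun y => (f y)^-1) (- f x ^- 2 * a).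
Proof. exact: is_deriveV. Qed.

End is_derive_pointwise.

Lemma ge0_is_derive_le (R : realType) (f df : R -> R) (a b : R) : a <= b ->
  (forall x, a <= x <= b -> is_derive x 1 f (df x)) ->
  (forall x, a <= x <= b -> 0 <= df x) -> f a <= f b.
Proof.
move=> ab fd df0; have [||c cab fE] := @MVT_segment R f df a b ab.
- by move=> x; rewrite in_itv /= => /andP[/ltW ax /ltW xb]; apply/fd/andP.
- apply: derivable_within_continuous => x; rewrite in_itv /= => xab.
  by have /@ex_derive := fd x xab.
rewrite -subr_ge0 fE mulr_ge0 ?subr_ge0//.
by apply: df0; rewrite in_itv in cab.
Qed.

(** The difference of the sides vanishes at 1 and has derivative (x - 1)^2 / (x (x + 1)^2). At t =
    (n + 1)/n the lower bound is exactly 1/(n + 1/2), which makes [stirling_log] decrease. *)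
Lemma ln_ge_pade (R : realType) (t : R) : 1 <= t -> 2 * (t - 1) / (t + 1) <= ln t.
Proof.
move=> t1.
have : ln 1 + 4 * (1 + 1)^-1 <= ln t + 4 * (t + 1)^-1.
  apply: (@ge0_is_derive_le R (fun x => ln x + 4 * (x + 1)^-1)
    (fun x => x^-1 + 4 * (- (x + 1) ^- 2))) => // x /andP[x1 _].
    have x0 : 0 < x by lra.
    apply: is_derive1D; first exact: is_derive1_ln.
    apply: is_derive1Z; rewrite -[X in is_derive _ _ _ X]mulr1.
    apply: is_derive1V; first by apply/eqP; lra.
    rewrite -[X in is_derive _ _ _ X]addr0.
    by apply: is_derive1D.
  have -> : x^-1 + 4 * - (x + 1) ^- 2 = (x - 1) ^+ 2 / (x * (x + 1) ^+ 2).
    by field; apply/andP; split; apply/eqP; lra.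
  by rewrite divr_ge0 ?sqr_ge0// mulr_ge0 ?sqr_ge0//; lra.
have -> : 2 * (t - 1) / (t + 1) = 2 - 4 * (t + 1)^-1.
  by field; apply/eqP; lra.
have -> : 4 * (1 + 1)^-1 = 2 :> R by field.
by rewrite ln1; lra.
Qed.

(** Twice the difference has derivative (1/x - 1)^2. At t = (n + 1)/n this bounds a step of
    [stirling_log] by the telescoping quantity 1/(4n) - 1/(4(n + 1)). *)
Lemma ln_le_half_subV (R : realType) (t : R) : 1 <= t -> ln t <= (t - t^-1) / 2.
Proof.
move=> t1.
have : 1 - 1^-1 - 2 * ln 1 <= t - t^-1 - 2 * ln t.
  apply: (@ge0_is_derive_le R (fun x => x - x^-1 - 2 * ln x)
    (fun x => 1 - (- x ^- 2) - 2 * x^-1)) => // x /andP[x1 _].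
    have x0 : 0 < x by lra.
    apply: is_derive1B; last by apply: is_derive1Z; exact: is_derive1_ln.
    apply: is_derive1B.
    rewrite -[X in is_derive _ _ _ X]mulr1.
    by apply: is_derive1V; apply/eqP; lra.
  have -> : 1 - - x ^- 2 - 2 * x^-1 = (x^-1 - 1) ^+ 2 by field; apply/eqP; lra.
  exact: sqr_ge0.
by rewrite ln1 invr1; lra.
Qed.

(** * Wallis integrals and the central binomial coefficient *)

(* Explicit primitives vanishing at 0: their values at pi/2 are the Wallis
   integrals, and no integration theory is needed. *)
Fixpoint cos_primitive (R : realType) (n : nat) : R -> R :=
  match n with
  | 0 => id
  | 1 => sin
  | (m.+1 as k).+1 => fun x =>
     (k.+1%:R)^-1 * (cos x ^+ k * sin x + k%:R * cos_primitive m x)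
  end.
Arguments cos_primitive : clear implicits.

Lemma is_derive_cos_primitive (R : realType) n (x : R) :
  is_derive x 1 (cos_primitive R n) (cos x ^+ n).
Proof.
elim/ltn_ind: n => -[|[|n]] IH.
- rewrite expr0; exact: is_derive_id.
- rewrite expr1; exact: is_derive_sin.
have Hn := IH n (ltnW (ltnSn _)).
have /= := is_derive1Z n.+2%:R^-1 (is_derive1D (is_derive1M
  (is_derive1X n.+1 (is_derive_cos x)) (is_derive_sin x)) (is_derive1Z n.+1%:R Hn)).
move/is_derive_eq; apply.
have -> : cos x ^+ n.+1 * cos x + sin x * (n.+1%:R * cos x ^+ n * - sin x)
  = cos x ^+ n.+2 - n.+1%:R * cos x ^+ n * (sin x ^+ 2) by rewrite !exprS; ring.
rewrite sin2cos2 -natr1 !exprS; field.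
by rewrite nat1r natr1 pnatr_eq0.
Qed.

Lemma cos_primitive0 (R : realType) n : cos_primitive R n 0 = 0.
Proof.
elim/ltn_ind: n => -[|[|n]] IH //=; first exact: sin0.
by rewrite sin0 IH// !mulr0 addr0 mulr0.
Qed.

Definition wallis (R : realType) (n : nat) : R := cos_primitive R n (pi / 2).
Arguments wallis : clear implicits.

Lemma wallis_rec (R : realType) n :
  n.+2%:R * wallis R n.+2 = n.+1%:R * wallis R n.
Proof.
rewrite /wallis /= cos_pihalf expr0n /= mul0r add0r mulrA divff ?mul1r//.
Qed.

Lemma wallis_nincr (R : realType) n : wallis R n.+1 <= wallis R n.
Proof.
have pi0 := @pi_gt0 R.
rewrite -subr_ge0 /wallis.
have -> : 0 = cos_primitive R n 0 - cos_primitive R n.+1 0.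
  by rewrite !cos_primitive0 subrr.
apply: (@ge0_is_derive_le R (fun x => cos_primitive R n x - cos_primitive R n.+1 x)
  (fun x => cos x ^+ n - cos x ^+ n.+1)) => [||x /andP[x0 xpi]]; first lra.
  move=> x _; apply: is_derive1B; exact: is_derive_cos_primitive.
have c0 : 0 <= cos x by apply: cos_ge0_pihalf; lra.
by rewrite subr_ge0 exprS ler_piMl ?exprn_ge0// cos_le1.
Qed.

(** The recurrence makes this product independent of n. *)
Lemma wallis_mul (R : realType) n :
  n.+1%:R * wallis R n.+1 * wallis R n = pi / 2.
Proof.
elim: n => [|n IH]; first by rewrite /wallis /= sin_pihalf !mul1r.
by rewrite wallis_rec mulrAC.
Qed.

Lemma wallis_gt0 (R : realType) n : 0 < wallis R n.
Proof.
have pi0 := @pi_gt0 R.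
elim/ltn_ind: n => -[|[|n]] IH.
- by rewrite /wallis /=; lra.
- by rewrite /wallis /= sin_pihalf.
have := wallis_rec R n => /(congr1 (fun z => n.+2%:R^-1 * z)).
rewrite mulKf ?pnatr_eq0// => ->.
by rewrite mulr_gt0 ?invr_gt0 ?mulr_gt0 ?ltr0n// IH.
Qed.

Lemma wallis_even (R : realType) n :
  wallis R n.*2 = pi / 2 * 'C(n.*2, n)%:R / 4 ^+ n.
Proof.
elim: n => [|n IH]; first by rewrite /wallis /= bin0 mulr1 divr1.
have := wallis_rec R n.*2; rewrite IH doubleS => /(congr1 (fun z => n.*2.+2%:R^-1 * z)).
rewrite mulKf ?pnatr_eq0// => ->.
have binE : (n.+1 ^ 2 * 'C(n.*2.+2, n.+1) = n.*2.+2 * n.*2.+1 * 'C(n.*2, n))%N.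
  have e1 := mul_bin_diag n.*2.+2 n; have e2 := mul_bin_down n.*2.+1 n.
  have e3 : (n.*2.+1 - n = n.+1)%N by lia.
  by rewrite /= in e1 e2; rewrite -mulnA e2 e3 mulnCA e1 mulnA mulnn.
have {binE} : (n.+1%:R ^+ 2 * 'C(n.*2.+2, n.+1)%:R =
   n.*2.+2%:R * n.*2.+1%:R * 'C(n.*2, n)%:R :> R) by rewrite -natrX -!natrM binE.
have -> : n.*2.+2%:R = 2 * n.+1%:R :> R by rewrite -doubleS -mul2n natrM.
move=> e.
have n1 : n.+1%:R != 0 :> R by rewrite pnatr_eq0.
have -> : 'C(n.*2.+2, n.+1)%:R = 2 * n.*2.+1%:R * 'C(n.*2, n)%:R / n.+1%:R :> R.
  by apply: (mulfI n1); apply: (mulfI n1); rewrite mulrA -expr2 e; field; rewrite nat1r.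
rewrite exprS; field.
by rewrite nat1r n1 /= expf_neq0// pnatr_eq0.
Qed.

(** For the Wallis integrals W, monotonicity and [wallis_mul] give W_(2n)^2 <= W_(2n) W_(2n-1) =
    pi/(4n), and W_(2n) is pi/2 times the base of the square. *)
Lemma central_bin_le (R : realType) n : (0 < n)%N ->
  ('C(n.*2, n)%:R / 4 ^+ n) ^+ 2 <= (pi * n%:R)^-1 :> R.
Proof.
case: n => // n _; have pi0 := @pi_gt0 R.
have := wallis_mul R n.*2.+1; have := wallis_nincr R n.*2.+1.
have := wallis_gt0 R n.*2.+2.
rewrite (wallis_even R n.+1 : wallis R n.*2.+2 = _) => w0 wle h.
have n0 : 0 < n.+1%:R :> R by rewrite ltr0n.
set B := _ / 4 ^+ n.+1; set w := wallis R n.*2.+1 in h wle.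
have {}h : 2 * n.+1%:R * (pi / 2 * B) * w = pi / 2.
  have e : n.*2.+2%:R = 2 * n.+1%:R :> R by rewrite -[n.*2.+2]doubleS -mul2n natrM.
  by rewrite -[RHS]h e /B !mulrA.
have {}w0 : 0 < pi / 2 * B by rewrite /B mulrA.
have {}wle : pi / 2 * B <= w by rewrite /B mulrA.
rewrite -[leRHS]mul1r ler_pdivlMr ?mulr_gt0//.
have B0 : 0 < B by move: w0; rewrite pmulr_rgt0// divr_gt0.
have : B * (2 * n.+1%:R * (pi / 2 * B)) <= B * (2 * n.+1%:R * w).
  by apply: ler_wpM2l; [exact: ltW|apply: ler_wpM2l => //; rewrite mulr_ge0].
have : 2 * n.+1%:R * B * w = 1.
  have p2 : pi / 2 != 0 :> R by apply/eqP; lra.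
  by apply: (mulfI p2); rewrite mulr1 -[RHS]h; ring.
nra.
Qed.

Lemma binomial_pmfE (R : realType) n (p : R) k :
  binomial_pmf n p k = 'C(n, k)%:R * p ^+ k * (1 - p) ^+ (n - k).
Proof. by rewrite /binomial_pmf -mulr_natl mulrA. Qed.

(** * Stirling bounds with explicit error *)

Section stirling.
Context {R : realType}.
Implicit Types n k l : nat.

(* The logarithm of n! e^n / n^(n + 1/2). *)
Definition stirling_log n : R := ln n`!%:R + n%:R - (n%:R + 2^-1) * ln n%:R.

Lemma ln_natS n : (0 < n)%N -> ln (n.+1%:R / n%:R) = ln n.+1%:R - ln n%:R :> R.
Proof. by move=> n0; rewrite ln_div ?posrE ?ltr0n. Qed.

Lemma stirling_log_sub n : (0 < n)%N -> stirling_log n - stirling_log n.+1 =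
  (n%:R + 2^-1) * ln (n.+1%:R / n%:R) - 1.
Proof.
move=> n0; rewrite ln_natS// /stirling_log factS natrM lnM ?posrE ?ltr0n ?fact_gt0//.
by rewrite -natr1; field.
Qed.

Lemma stirling_log_nincr n : (0 < n)%N -> stirling_log n.+1 <= stirling_log n.
Proof.
move=> n0; rewrite -subr_ge0 stirling_log_sub// subr_ge0.
have n0' : 0 < n%:R :> R by rewrite ltr0n.
have t1 : 1 <= n.+1%:R / n%:R :> R by rewrite ler_pdivlMr// mul1r ler_nat.
apply: le_trans (ler_wpM2l _ (ln_ge_pade t1)); last by rewrite addr_ge0.
rewrite le_eqVlt; apply/orP; left; apply/eqP; rewrite -natr1; field.
by apply/andP; split; apply/eqP; lra.
Qed.

Lemma stirling_log_subV_ndecr n : (0 < n)%N ->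
  stirling_log n - (4 * n%:R)^-1 <= stirling_log n.+1 - (4 * n.+1%:R)^-1.
Proof.
move=> n0.
suff : stirling_log n - stirling_log n.+1 <= (4 * n%:R)^-1 - (4 * n.+1%:R)^-1.
  by set a := (4 * n%:R)^-1; set b := (4 * _)^-1; lra.
rewrite stirling_log_sub//.
have n0' : 0 < n%:R :> R by rewrite ltr0n.
have t1 : 1 <= n.+1%:R / n%:R :> R by rewrite ler_pdivlMr// mul1r ler_nat.
rewrite lerBlDr; apply: le_trans (ler_wpM2l _ (ln_le_half_subV t1)) _.
  by rewrite addr_ge0.
rewrite le_eqVlt; apply/orP; left; apply/eqP; rewrite -natr1; field.
by apply/andP; split; apply/eqP; lra.
Qed.

Lemma stirling_log_le n k : (0 < n)%N -> (n <= k)%N ->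
  stirling_log k <= stirling_log n.
Proof.
move=> n0 /subnKC <-; elim: (k - n)%N => [|j IH]; first by rewrite addn0.
by rewrite addnS (le_trans (stirling_log_nincr _)) ?addn_gt0 ?n0.
Qed.

Lemma stirling_log_sub_le n k : (0 < n)%N -> (n <= k)%N ->
  stirling_log n - stirling_log k <= (4 * n%:R)^-1.
Proof.
move=> n0 nk.
suff : stirling_log n - (4 * n%:R)^-1 <= stirling_log k - (4 * k%:R)^-1.
  have : 0 <= (4 * k%:R)^-1 :> R by rewrite invr_ge0 mulr_ge0.
  lra.
move: nk => /subnKC <-; elim: (k - n)%N => [|j IH]; first by rewrite addn0.
by rewrite addnS (le_trans IH)// stirling_log_subV_ndecr// addn_gt0 n0.
Qed.

(* Wallis gives 2 L n >= L (2n) + ln(2 pi)/2 for L = stirling_log, and L (2n) is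
   within 1/(4n) of L n, so no limit has to be taken. *)
Lemma stirling_log_ge n : (0 < n)%N ->
  ln (2 * pi) / 2 - (4 * n%:R)^-1 <= stirling_log n.
Proof.
move=> n0; have n0' : 0 < n%:R :> R by rewrite ltr0n.
have pi0 := @pi_gt0 R.
have n2 : (n <= n.*2)%N by rewrite -addnn leq_addr.
have := stirling_log_sub_le n0 n2; have := @central_bin_le R n n0.
have binE : ('C(n.*2, n) * (n`! * n`!) = n.*2`!)%N.
  by rewrite -[in RHS](bin_fact n2) -addnn addnK.
have C0 : 0 < 'C(n.*2, n)%:R :> R by rewrite ltr0n bin_gt0.
have f0 : 0 < n`!%:R :> R by rewrite ltr0n fact_gt0.
have X0 : 0 < ('C(n.*2, n)%:R / 4 ^+ n) ^+ 2 :> R.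
  by rewrite exprn_gt0// divr_gt0// exprn_gt0.
rewrite -ler_ln ?posrE ?invr_gt0 ?mulr_gt0// lnV ?posrE ?mulr_gt0//.
rewrite lnXn ?divr_gt0 ?exprn_gt0// ln_div ?posrE ?exprn_gt0// lnXn//.
have -> : 4 = 2 * 2 :> R by rewrite -natrM.
rewrite !lnM ?posrE// mulr2n.
rewrite /stirling_log -binE !natrM !lnM ?posrE ?mulr_gt0//.
rewrite -mul2n natrM lnM ?posrE// -[_ *+ n]mulr_natr.
set e := (2 * 2 * _)^-1; set B := ln 2; set C := ln pi; set X := ln n%:R.
set Y := ln _; set Z := ln _.

lra.
Qed.

(** Gibbs' inequality: with m = k + l, the law (k/m, l/m) has nonnegative entropy relative to (p, 1
    - p). So p^k (1 - p)^l is at most its value at p = k/m. *)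
Lemma bin_pmf_le_gibbs k l (p : R) : (0 < k)%N -> (0 < l)%N -> 0 < p < 1 ->
  k%:R * ln p + l%:R * ln (1 - p) + (k + l)%:R * ln (k + l)%:R
   <= k%:R * ln k%:R + l%:R * ln l%:R.
Proof.
move=> k0 l0 /andP[p0 p1]; have q0 : 0 < 1 - p by lra.
have m0 : 0 < (k + l)%:R :> R by rewrite ltr0n addn_gt0 k0.
have {}k0 : 0 < k%:R :> R by rewrite ltr0n.
have {}l0 : 0 < l%:R :> R by rewrite ltr0n.
(* This is ln u <= u - 1 at u = y (k + l)/x; the right-hand sides of the two instances used add up
   to 0. *)
have H (x y : R) : 0 < x -> 0 < y ->
    x * (ln y + ln (k + l)%:R - ln x) <= (k + l)%:R * y - x.
  move=> x0 y0; rewrite -lnM ?posrE// -ln_div ?posrE ?mulr_gt0//.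
  have := @le_ln1Dx R (y * (k + l)%:R / x - 1).
  have : 0 < y * (k + l)%:R / x by rewrite divr_gt0// mulr_gt0.
  set t := _ / x => t0; rewrite [1 + _]addrC subrK => h.
  apply: le_trans (ler_wpM2l (ltW x0) (h _)) _; first lra.
  by rewrite mulrBr mulr1 /t mulrC divfK ?gt_eqF// mulrC.
have := H _ _ k0 p0; have := H _ _ l0 q0; rewrite natrD; lra.
Qed.

Lemma binomial_pmf_local k l (p : R) : (0 < k)%N -> (0 < l)%N -> 0 < p < 1 ->
  binomial_pmf (k + l) p k <=
  expR (2 * (k + l)%:R)^-1 * Num.sqrt ((k + l)%:R / (2 * pi * k%:R * l%:R)).
Proof.
move=> k0 l0 p01; have [p0 p1] := andP p01; have q0 : 0 < 1 - p by lra.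
have gibbs := bin_pmf_le_gibbs k0 l0 p01.
have pi0 := @pi_gt0 R.
have binE : ('C(k + l, k) * (k`! * l`!) = (k + l)`!)%N.
  by rewrite -[in RHS](bin_fact (leq_addr l k)) addKn.
have C0 : 0 < 'C(k + l, k)%:R :> R by rewrite ltr0n bin_gt0 leq_addr.
have m0 : 0 < (k + l)%:R :> R by rewrite ltr0n addn_gt0 k0.
have kR : 0 < k%:R :> R by rewrite ltr0n.
have lR : 0 < l%:R :> R by rewrite ltr0n.
rewrite binomial_pmfE addKn.
rewrite -ler_ln ?posrE ?mulr_gt0 ?exprn_gt0 ?expR_gt0 ?sqrtr_gt0 ?divr_gt0 ?mulr_gt0//.
rewrite !lnM ?posrE ?mulr_gt0 ?exprn_gt0 ?expR_gt0 ?sqrtr_gt0 ?divr_gt0 ?mulr_gt0//.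
rewrite expRK -[Num.sqrt _]powR12_sqrt ?ln_powR ?divr_ge0 ?mulr_ge0//; last lra.
rewrite ln_div ?posrE ?mulr_gt0// !lnM ?posrE ?mulr_gt0// !lnXn//.
have fE : ln 'C(k + l, k)%:R = ln (k + l)`!%:R - ln k`!%:R - ln l`!%:R :> R.
  by rewrite -binE !natrM !lnM ?posrE ?mulr_gt0 ?ltr0n ?fact_gt0 ?bin_gt0 ?leq_addr//; ring.
have S : stirling_log (k + l) - stirling_log k - stirling_log l
    <= (2 * (k + l)%:R)^-1 - (ln 2 + ln pi) / 2.
  (* L (a + b) <= L a as L decreases, so only the larger index b costs an error. *)
  have H a b : (0 < a)%N -> (a <= b)%N ->
     stirling_log (a + b) - stirling_log a - stirling_log b
    <= (2 * (a + b)%:R)^-1 - (ln 2 + ln pi) / 2.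
    move=> a0 ab; have b0 := leq_trans a0 ab.
    have := stirling_log_le a0 (leq_addr b a); have := stirling_log_ge b0.
    rewrite lnM ?posrE//.
    have : (4 * b%:R)^-1 <= (2 * (a + b)%:R)^-1 :> R.
      rewrite lef_pV2 ?posrE ?mulr_gt0 ?ltr0n ?addn_gt0 ?a0//.
      have : a%:R <= b%:R :> R by rewrite ler_nat.
      rewrite natrD; lra.
    lra.
  have [kl|/ltnW lk] := leqP k l; first exact: H.
  by have := H _ _ l0 lk; rewrite [(l + k)%N]addnC; lra.
move: S; rewrite /stirling_log fE -2!mulr_natr.
move=> S; have := lerD S gibbs; rewrite -subr_ge0 => SG.
rewrite -subr_ge0 (le_trans SG)// le_eqVlt; apply/orP; left; apply/eqP.
rewrite natrD; field.
by rewrite -natrD gt_eqF.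
Qed.

End stirling.

(** * The lower tail of the binomial law *)

Section binomial_tail.
Context {R : realType}.
Implicit Types (p : R) (m k r : nat).

Lemma binomial_pmf0 m p k : (m < k)%N -> binomial_pmf m p k = 0.
Proof. by move=> mk; rewrite binomial_pmfE bin_small// !mul0r. Qed.

Lemma binomial_pmf_rec m p k :
  k.+1%:R * (1 - p) * binomial_pmf m p k.+1 = (m - k)%:R * p * binomial_pmf m p k.
Proof.
rewrite !binomial_pmfE; have [mk|km] := leqP m k.
  by rewrite bin_small ?ltnS// (eqP mk) !mul0r mulr0.
have -> : (m - k = (m - k.+1).+1)%N by lia.
have : k.+1%:R * 'C(m, k.+1)%:R = (m - k)%:R * 'C(m, k)%:R :> R.
  by rewrite -!natrM mul_bin_left.
have -> : (m - k = (m - k.+1).+1)%N by lia.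
move=> e; rewrite !exprS.
transitivity (p * (1 - p) * p ^+ k * (1 - p) ^+ (m - k.+1) * (k.+1%:R * 'C(m, k.+1)%:R)).
  by ring.
by rewrite e; ring.
Qed.

Lemma binomial_pmfS m p k : binomial_pmf m.+1 p k.+1 =
  p * binomial_pmf m p k + (1 - p) * binomial_pmf m p k.+1.
Proof.
rewrite !binomial_pmfE binS natrD subSS; have [mk|km] := leqP m k.
  by rewrite ['C(m, k.+1)]bin_small ?ltnS// exprS; ring.
have -> : (m - k = (m - k.+1).+1)%N by lia.
by rewrite !exprS; ring.
Qed.

Definition binomial_tail m p r : R := \sum_(r <= k < m.+1) binomial_pmf m p k.

Lemma binomial_tail_ge0 m p r : 0 <= p <= 1 -> 0 <= binomial_tail m p r.
Proof. by move=> p01; apply: sumr_ge0 => k _; exact: binomial_pmf_ge0. Qed.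

Lemma binomial_tail_small m p r : (m < r)%N -> binomial_tail m p r = 0.
Proof. by move=> mr; rewrite /binomial_tail big_geq. Qed.

Lemma binomial_tail0 m p : binomial_tail m p 0 = 1.
Proof.
rewrite /binomial_tail big_mkord.
have -> : 1 = (1 - p + p) ^+ m by rewrite subrK expr1n.
rewrite exprDn; apply: eq_bigr => k _.
by rewrite binomial_pmfE -mulr_natl; ring.
Qed.

Lemma binomial_tail_recl m p r :
  binomial_tail m p r = binomial_pmf m p r + binomial_tail m p r.+1.
Proof.
have [mr|rm] := ltnP m r.
  by rewrite !binomial_tail_small ?(ltnW mr)// ?binomial_pmf0 ?addr0// ltnW.
by rewrite /binomial_tail big_ltn.
Qed.

Lemma binomial_tail_nincr m p r : 0 <= p <= 1 ->
  binomial_tail m p r.+1 <= binomial_tail m p r.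
Proof. by move=> p01; rewrite (binomial_tail_recl m p r) lerDr binomial_pmf_ge0. Qed.

(** Conditioning on one trial. The truncated predecessor is harmless at r = 0, where all tails are
    1. *)
Lemma binomial_tailS m p r : binomial_tail m.+1 p r =
  p * binomial_tail m p r.-1 + (1 - p) * binomial_tail m p r.
Proof.
case: r => [|r] /=; first by rewrite !binomial_tail0; ring.
rewrite {1}/binomial_tail big_add1 /=.
under eq_bigr do rewrite binomial_pmfS.
rewrite big_split /= -!mulr_sumr -/(binomial_tail m p r); congr (_ + _ * _).
have [mr|rm] := leqP m.+1 r; first by rewrite big_geq// binomial_tail_small// leqW.
transitivity (\sum_(r.+1 <= k < m.+2) binomial_pmf m p k); first by rewrite big_add1.
by rewrite big_nat_recr//= binomial_pmf0// addr0.
Qed.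

(** By induction on m through [binomial_tailS]: raising p shifts weight to the larger of the two
    tails. *)
Lemma binomial_tail_le_prob m p p' r : 0 <= p -> p <= p' -> p' <= 1 ->
  binomial_tail m p r <= binomial_tail m p' r.
Proof.
move=> p0 pp' p'1; elim: m r => [|m IH] r.
  case: r => [|r]; first by rewrite !binomial_tail0.
  by rewrite !binomial_tail_small.
rewrite !binomial_tailS.
have p01 : 0 <= p <= 1 by rewrite p0 (le_trans pp').
have := IH r; have := IH r.-1.
have : binomial_tail m p r <= binomial_tail m p r.-1.
  by case: r => //= r; exact: binomial_tail_nincr.
nra.
Qed.

End binomial_tail.

(** * The median of a binomial law with integer mean *)

(* Multiplying through by the two positive factors avoids the division in the
   ratios x' / x and y / y'. *)
Lemma le_of_ratio (R : realFieldType) (a b c d x x' y y' : R) :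
  0 < a -> 0 < d -> 0 <= b -> 0 <= y ->
  a * x' = b * x -> c * y = d * y' -> a * c <= b * d -> y <= x -> y' <= x'.
Proof.
move=> a0 d0 b0 y0 xE yE h yx.
have ad0 : 0 < a * d by rewrite mulr_gt0.
rewrite -(ler_pM2l ad0).
have -> : a * d * y' = a * c * y by rewrite -!mulrA -yE.
have -> : a * d * x' = b * d * x by rewrite mulrAC xE mulrAC.
by apply: (le_trans (ler_wpM2r y0 h)); rewrite ler_wpM2l// mulr_ge0// ltW.
Qed.

(** Stated additively because of truncated subtraction: the two ratio products differ by (k - l)((k
    + l) j (j + 1) - k l), whose sign is governed by j alone once k >= l. *)
Lemma reflect_ratioE (k l j : nat) : (j <= l)%N -> (l <= k)%N ->
  ((k + j).+1 * l * ((k - j) * l) + (k - l) * (k * l) =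
   (l - j) * k * ((l + j).+1 * k) + (k - l) * ((k + l) * (j * j.+1)))%N.
Proof.
move=> jl lk; have [a lE] : {a | l = j + a}%N by exists (l - j)%N; rewrite subnKC.
have [c kE] : {c | k = l + c}%N by exists (k - l)%N; rewrite subnKC.
have -> : (k - j = a + c)%N by lia.
have -> : (l - j = a)%N by lia.
have -> : (k - l = c)%N by lia.
by rewrite kE lE; ring.
Qed.

Section binomial_median.
Context {R : realType} (k l : nat).
Hypotheses (k0 : (0 < k)%N) (l0 : (0 < l)%N).
Let m := (k + l)%N.
Let p : R := k%:R / m%:R.
Let b := binomial_pmf m p.

Let kR : 0 < k%:R :> R. Proof. by rewrite ltr0n. Qed.
Let lR : 0 < l%:R :> R. Proof. by rewrite ltr0n. Qed.
Let mE : m%:R = k%:R + l%:R :> R. Proof. by rewrite natrD. Qed.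
Let mR : 0 < m%:R :> R. Proof. by rewrite mE addr_gt0. Qed.

Let p01 : 0 <= p <= 1.
Proof.
rewrite divr_ge0 ?ler0n//= ler_pdivrMr// mul1r mE lerDl ltW//.
Qed.

Let b_ge0 i : 0 <= b i. Proof. exact: binomial_pmf_ge0. Qed.

Let b_rec i : i.+1%:R * l%:R * b i.+1 = (m - i)%:R * k%:R * b i.
Proof.
have := binomial_pmf_rec m p i; rewrite -/b.
have mN : m%:R != 0 :> R by rewrite gt_eqF.
have -> : 1 - p = l%:R / m%:R.
  by apply: (mulIf mN); rewrite mulrBl !divfK// mul1r mE addrAC subrr add0r.
rewrite /p => /(congr1 (fun x => m%:R * x)).
have e (x y z : R) : m%:R * (x * (y / m%:R) * z) = x * y * z by field.
by rewrite !e.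
Qed.

Let b_sum : \sum_(i < m.+1) b i = 1.
Proof. by rewrite -(binomial_tail0 m p) /binomial_tail big_mkord. Qed.

(** Reflection about k - 1/2, by induction on the distance: moving outwards, the right atom shrinks
    relatively no faster than the left one. *)
Lemma pmf_reflect_le j : (k <= l)%N -> (j < k)%N -> b (k - j.+1) <= b (k + j).
Proof.
move=> kl; elim: j => [|j IH] jk.
  rewrite addn0; have := b_rec (k - 1); rewrite subnSK// subn0.
  have -> : (m - (k - 1) = l.+1)%N by rewrite /m; lia.
  rewrite -natr1 => e; have := b_ge0 (k - 1); have := b_ge0 k.
  have : l%:R * k%:R * b (k - 1) <= l%:R * k%:R * b k.
    rewrite [X in _ <= X * _]mulrC e ler_wpM2r// ler_wpM2r ?ler0n//; lra.
  by rewrite ler_pM2l// mulr_gt0.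
have ix : (k + j).+1%:R * l%:R * b (k + j.+1) = (l - j)%:R * k%:R * b (k + j).
  have := b_rec (k + j); rewrite addnS => ->; congr (_%:R * _ * _).
  by rewrite /m; lia.
have iy : (k - j.+1)%:R * l%:R * b (k - j.+1) = (l + j.+2)%:R * k%:R * b (k - j.+2).
  have := b_rec (k - j.+2).
  have -> : (k - j.+2).+1 = (k - j.+1)%N by lia.
  by move=> ->; congr (_%:R * _ * _); rewrite /m; lia.
apply: (le_of_ratio _ _ _ _ ix iy _ (IH (ltnW jk))) => //.
- by rewrite mulr_gt0// ltr0n.
- by rewrite mulr_gt0// ltr0n addn_gt0 l0.
- rewrite -!natrM ler_nat.
  (* Writing k = a + j + 1 and l = k + c removes the subtractions and turns the difference of the
     sides into a sum of nonnegative terms. *)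
  suff H a c K L : K = (a + j.+1)%N -> L = (K + c)%N ->
      ((K + j).+1 * L * (a * L) <= (a + c + 1) * K * ((L + j.+2) * K))%N.
    have -> : (l - j = k - j.+1 + (l - k) + 1)%N by lia.
    by apply: H; lia.
  move=> KE LE.
  suff -> : ((a + c + 1) * K * ((L + j.+2) * K) = (K + j).+1 * L * (a * L) +
     (K * K * (2 * L + 1) + j.+1 * j.+1 * (c * (2 * K + c))))%N by exact: leq_addr.
  by rewrite LE KE; ring.
Qed.

(** The atom at distance j below k. The explicit 0 matters: for j > k truncated subtraction would
    return [b 0]. *)
Let Y j : R := if (j <= k)%N then b (k - j) else 0.

Lemma sum_shift (F : nat -> R) : (forall i, (m < i)%N -> F i = 0) ->
  \sum_(j < m.+1) F (k + j)%N = \sum_(k <= i < m.+1) F i.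
Proof.
move=> F0; rewrite -(big_mkord predT (fun j => F (k + j)%N)).
rewrite -[in RHS](add0n k) big_addn (big_cat_nat (n := m.+1 - k))//= ?leq_subr//.
rewrite [X in _ + X]big_nat [X in _ + X]big1 ?addr0.
  by apply: eq_bigr => i _; rewrite addnC.
by move=> i /andP[i1 _]; apply: F0; lia.
Qed.

(** Points are grouped by their distance j to k; k itself is counted on both sides, hence the extra
    [F k]. *)
Lemma sum_fold (F : nat -> R) : (forall i, (m < i)%N -> F i = 0) ->
  \sum_(i < m.+1) F i + F k = \sum_(j < m.+1) F (k + j)%N +
    \sum_(j < m.+1) (if (j <= k)%N then F (k - j)%N else 0).
Proof.
move=> F0; have km : (k <= m)%N by rewrite leq_addr.
have -> : \sum_(j < m.+1) (if (j <= k)%N then F (k - j)%N else 0) =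
    \sum_(i < k.+1) F i.
  rewrite -big_mkcond /= -(big_mkord (fun j => j <= k)%N (fun j => F (k - j)%N)).
  rewrite (big_cat_nat (n := k.+1))//= [X in _ + X]big_nat_cond [X in _ + X]big_pred0 ?addr0.
    rewrite big_mkord [RHS](reindex_inj rev_ord_inj) /=.
    by apply: eq_big => [i|i _]; rewrite ?subSS// -ltnS ltn_ord.
  by move=> i; apply/negbTE; lia.
rewrite [X in _ = _ + X]big_ord_recr /= addrA; congr (_ + _).
rewrite [RHS]addrC.
rewrite sum_shift//.
by rewrite -!(big_mkord predT F) -(big_cat_nat (n := k))// ltnW.
Qed.

Let Y_ge0 j : 0 <= Y j. Proof. by rewrite /Y; case: ifP. Qed.

Let b_gt i : (m < i)%N -> b i = 0. Proof. exact: binomial_pmf0. Qed.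

Let X_rec j : (k + j).+1%:R * l%:R * b (k + j.+1) = (l - j)%:R * k%:R * b (k + j).
Proof. by rewrite addnS b_rec; congr (_%:R * _ * _); rewrite /m; lia. Qed.

Let Y_rec j : (k - j)%:R * l%:R * Y j = (l + j).+1%:R * k%:R * Y j.+1.
Proof.
rewrite /Y; case: ltngtP => jk; last by rewrite jk subnn !mul0r mulr0.
  have := b_rec (k - j.+1); rewrite subnSK// => ->.
  by congr (_%:R * _ * _); rewrite /m; lia.
by rewrite !mulr0.
Qed.

(** In this range of j, [reflect_ratioE] shows that [b (k + j)] loses relatively no more than [Y j]
    at the next step; [D_down] is the opposite range. *)
Let D_up j : (l <= k)%N -> (m * (j * j.+1) <= k * l)%N ->
  Y j <= b (k + j) -> Y j.+1 <= b (k + j.+1).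
Proof.
move=> lk jm; apply: (le_of_ratio _ _ _ _ (X_rec j) (Y_rec j)) => //.
- by rewrite mulr_gt0// ltr0n.
- by rewrite mulr_gt0// ltr0n.
- rewrite -!natrM ler_nat.
  have jl : (j < l)%N by rewrite ltnNge; apply/negP => lj; move: jm; rewrite /m; nia.
  have := reflect_ratioE (ltnW jl) lk.
  have : ((k - l) * (m * (j * j.+1)) <= (k - l) * (k * l))%N by rewrite leq_mul2l jm orbT.
  by rewrite -/m; lia.
Qed.

Let D_down j : (l <= k)%N -> (k * l <= m * (j * j.+1))%N ->
  b (k + j) <= Y j -> b (k + j.+1) <= Y j.+1.
Proof.
move=> lk jm bY; have [jl|lj] := ltnP j l; last first.
  by rewrite b_gt// /m; lia.
apply: (le_of_ratio _ _ _ _ (esym (Y_rec j)) (esym (X_rec j)) _ bY) => //.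
- by rewrite mulr_gt0// ltr0n.
- by rewrite mulr_gt0// ltr0n.
- rewrite -!natrM ler_nat.
  have := reflect_ratioE (ltnW jl) lk.
  have : ((k - l) * (k * l) <= (k - l) * (m * (j * j.+1)))%N by rewrite leq_mul2l jm orbT.
  by rewrite -/m [((l + j).+1 * k * _)%N]mulnC [((k - j) * l * _)%N]mulnC; lia.
Qed.

(* D changes sign exactly once, at J; as the mean of the binomial law is k,
   sum j D_j = 0, and summing (J - j) D_j >= 0 gives sum D_j >= 0. *)
Lemma binomial_median_ge : (l <= k)%N -> 2^-1 <= binomial_tail m p k.
Proof.
move=> lk; pose D j := b (k + j) - Y j.
have D0 : D 0%N = 0 by rewrite /D /Y addn0 subn0 subrr.
have exJ : exists j, (0 < j)%N && (k * l <= m * (j * j.+1))%N && (D j <= 0).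
  exists m; rewrite subr_le0 b_gt ?Y_ge0 ?andbT; last by rewrite /m; lia.
  by rewrite /m; nia.
case: (ex_minnP exJ) => J /andP[/andP[J0 mJ] DJ] Jmin.
have DgeJ j : (J <= j)%N -> D j <= 0.
  move=> /subnKC <-; elim: (j - J)%N => [|i IH]; first by rewrite addn0.
  rewrite addnS subr_le0; apply: D_down => //; last by rewrite -subr_le0.
  by rewrite (leq_trans mJ)// leq_mul2l leq_mul ?orbT ?leq_addr// ltnS leq_addr.
have DltJ j : (j < J)%N -> 0 <= D j.
  move=> jJ; have [j0|j0] := posnP j; first by rewrite j0 D0.
  have [kl|kl] := leqP (k * l) (m * (j * j.+1)).
    rewrite leNgt; apply/negP => /ltW Dj.
    by have := Jmin j; rewrite j0 kl Dj leqNgt jJ => /(_ isT).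
  elim: j {jJ j0} kl => [|j IH] kl; first by rewrite D0.
  rewrite subr_ge0; apply: D_up => //; last rewrite -subr_ge0 IH//.
    by apply: leq_trans (ltnW kl); rewrite leq_mul2l leq_mul ?orbT.
  by apply: leq_ltn_trans kl; rewrite leq_mul2l leq_mul ?orbT.
have foldb := sum_fold b_gt.
have foldc : forall i, (m < i)%N -> (i%:R - k%:R) * b i = 0.
  by move=> i /b_gt ->; rewrite mulr0.
move/sum_fold in foldc.
have mean : \sum_(i < m.+1) (i%:R - k%:R) * b i = 0.
  (* [b_rec] together with m (i - k) = i l - (m - i) k makes the centred sum telescope. *)
  have tele i : m%:R * ((i%:R - k%:R) * b i) =
      i%:R * l%:R * b i - i.+1%:R * l%:R * b i.+1.
    rewrite b_rec; have [im|mi] := leqP i m; last by rewrite b_gt// !mulr0 subrr.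
    by rewrite natrB// mE; ring.
  have m0 : m%:R != 0 :> R by rewrite gt_eqF.
  apply: (mulfI m0); rewrite mulr_sumr mulr0.
  under eq_bigr do rewrite tele.
  rewrite -(big_mkord predT (fun i => i%:R * l%:R * b i - i.+1%:R * l%:R * b i.+1)).
  rewrite -[LHS]opprK -sumrN; under eq_bigr do rewrite opprB.
  by rewrite telescope_sumr// b_gt// mulr0 !mul0r subrr oppr0.
move: foldc; rewrite mean subrr mul0r addr0.
have -> : \sum_(j < m.+1) ((k + j)%:R - k%:R) * b (k + j) =
  \sum_(j < m.+1) j%:R * b (k + j).
  by apply: eq_bigr => j _; rewrite natrD addrAC subrr add0r.
have -> : \sum_(j < m.+1) (if (j <= k)%N then ((k - j)%:R - k%:R) * b (k - j) else 0) =
  - \sum_(j < m.+1) j%:R * Y j.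
  rewrite -sumrN; apply: eq_bigr => j _; rewrite /Y; case: ifP => jk; last by rewrite mulr0 oppr0.
  by rewrite natrB//; ring.
move=> foldc.
have : 0 <= \sum_(j < m.+1) (J%:R - j%:R) * D j.
  apply: sumr_ge0 => j _; have [Jj|jJ] := leqP J j.
    by rewrite mulr_le0 ?DgeJ// subr_le0 ler_nat.
  by rewrite mulr_ge0 ?DltJ// subr_ge0 ler_nat ltnW.
have -> : \sum_(j < m.+1) (J%:R - j%:R) * D j =
    J%:R * (\sum_(j < m.+1) b (k + j) - \sum_(j < m.+1) Y j).
  rewrite -[RHS]subr0 [X in _ = _ - X]foldc -!sumrB mulr_sumr -sumrB.
  by apply: eq_bigr => j _; rewrite /D; ring.
rewrite pmulr_rge0 ?ltr0n// => XY.
have tailE : binomial_tail m p k = \sum_(j < m.+1) b (k + j) by rewrite sum_shift.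
(* Both sides together have mass 1 + b k, and the right side has at least as much as the left. *)
move: foldb; rewrite b_sum -/(Y _) tailE.
have := b_ge0 k.
lra.
Qed.

(** By [pmf_reflect_le] the atoms below k are dominated one by one by those at k, ..., 2k - 1. *)
Lemma binomial_median_le : (k <= l)%N -> 2^-1 <= binomial_tail m p k.
Proof.
move=> kl.
suff : \sum_(i < k) b i <= binomial_tail m p k.
  have := b_sum; rewrite -(big_mkord predT b) (big_cat_nat (n := k))//=; last first.
    by rewrite leqW// leq_addr.
  by rewrite big_mkord -/(binomial_tail m p k); lra.
rewrite (reindex_inj rev_ord_inj) /= /binomial_tail.
rewrite (big_cat_nat (n := (k + k)%N))/= ?leq_addr//; last by rewrite /m; lia.
apply: (@le_trans _ _ (\sum_(k <= i < k + k) b i)); last by rewrite lerDl sumr_ge0.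
rewrite -[X in _ <= \sum_(X <= _ < _) _]add0n big_addn addnK big_mkord.
by apply: ler_sum => i _; rewrite [(i + k)%N]addnC pmf_reflect_le.
Qed.

End binomial_median.

(** * Quantitative lower bound on the tail *)

Section binomial_lower_tail.
Context {R : realType}.
Implicit Types (p t : R) (m k r : nat).

(** With f the floor of the mean, lowering p to f/m can only shrink the tail and makes the mean the
    integer f, where the median lemmas apply. *)
Lemma binomial_tail_truncn m p : 0 < p < 1 ->
  2^-1 <= binomial_tail m p (Num.truncn (m%:R * p)).
Proof.
move=> /andP[p0 p1]; have [m0|m0] := posnP m.
  by rewrite m0 mul0r truncn0 binomial_tail0 invf_le1 ?ler1n.
have mR : 0 < m%:R :> R by rewrite ltr0n.
have /andP[] := truncn_itv (ltW (mulr_gt0 mR p0)).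
set f := Num.truncn _ => fle _.
have [->|f0] := posnP f; first by rewrite binomial_tail0 invf_le1 ?ler1n.
have fm : (f < m)%N.
  by rewrite -(ltr_nat R) (le_lt_trans fle)// gtr_pMr.
have l0 : (0 < m - f)%N by rewrite subn_gt0.
have mE := subnKC (ltnW fm).
have -> : binomial_tail m p f = binomial_tail (f + (m - f)) p f by rewrite mE.
apply: (@le_trans _ _ (binomial_tail (f + (m - f)) (f%:R / (f + (m - f))%:R) f)).
  have [/binomial_median_le|/ltnW /binomial_median_ge] := leqP f (m - f); exact.
rewrite mE; apply: binomial_tail_le_prob; rewrite ?divr_ge0 ?(ltW p1)//.
by rewrite ler_pdivrMr// mulrC.
Qed.

Lemma binomial_pmf_nincr m p k : 0 <= p <= 1 -> m%:R * p <= k%:R ->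
  p < 1 -> binomial_pmf m p k.+1 <= binomial_pmf m p k.
Proof.
move=> p01 mpk p1; have [mk|km] := leqP m k.
  by rewrite [leLHS]binomial_pmf0 ?ltnS// binomial_pmf_ge0.
have q0 : 0 < 1 - p by lra.
rewrite -(ler_pM2l (mulr_gt0 (ltr0Sn R k) q0)) binomial_pmf_rec.
rewrite ler_wpM2r ?binomial_pmf_ge0// natrB ?(ltnW km)// -natr1.
rewrite mulrBl mulrDl mul1r mulrBr mulr1; lra.
Qed.

(** Near the mean, [binomial_pmf_local] exceeds the Gaussian value by a factor at most 1 + 1/(4 s^2)
    from the exponential and 1 + 1/s from the root. *)
Lemma binomial_pmf_le_near_mean m p k (s := Num.sqrt (m%:R * p * (1 - p))) :
  0 < p < 1 -> 2 <= s -> m%:R * p - 1 <= k%:R <= m%:R * p + 1 ->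
  binomial_pmf m p k <= (1 + 2 / s) / (Num.sqrt (2 * pi) * s).
Proof.
move=> p01 s2 /andP[kge kle]; have [p0 p1] := andP p01.
have pi0 := @pi_gt0 R; have q0 : 0 < 1 - p by lra.
have m0 : 0 <= m%:R :> R by [].
have s2E : s ^+ 2 = m%:R * p * (1 - p).
  by rewrite sqr_sqrtr// mulr_ge0 ?mulr_ge0// ltW.
have s4 : 4 <= s ^+ 2 by nra.
have mp4 : 4 <= m%:R * p by nra.
have mq4 : 4 <= m%:R * (1 - p) by nra.
have kR : 0 < k%:R :> R by lra.
have k0 : (0 < k)%N by rewrite -(ltr_nat R).
have km : (k < m)%N by rewrite -(ltr_nat R); lra.
have lE : (m - k)%:R = m%:R - k%:R :> R by rewrite natrB// ltnW.
have lR : 0 < (m - k)%:R :> R by rewrite lE; lra.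
have l0 : (0 < m - k)%N by rewrite subn_gt0.
have mR : 0 < m%:R :> R by lra.
have := @binomial_pmf_local R k (m - k) p k0 l0 p01.
rewrite subnKC ?(ltnW km)// => /le_trans; apply.
(* As k is within 1 of mp, the product k (m - k) falls below m s^2 by at most m. *)
have kl : m%:R * (s ^+ 2 - 1) <= k%:R * (m - k)%:R.
  by rewrite s2E lE; nra.
have ms : 4 * s ^+ 2 <= m%:R.
  rewrite s2E; have : 0 <= m%:R * (1 - 2 * p) ^+ 2 by rewrite mulr_ge0 ?sqr_ge0.
  lra.
have e1 : expR (2 * m%:R)^-1 <= 1 + (4 * s ^+ 2)^-1.
  set x := (2 * m%:R)^-1; set y := (4 * s ^+ 2)^-1.
  have x0 : 0 < x by rewrite invr_gt0 mulr_gt0.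
  have xy : 2 * x <= y.
    rewrite /x invfM mulrA divff// mul1r lef_pV2 ?posrE ?mulr_gt0//; lra.
  have x8 : 8 * x <= 1 by rewrite /x ler_pdivrMr ?mulr_gt0//; lra.
  apply: (@le_trans _ _ (1 - x)^-1); last first.
    rewrite -[leLHS]mul1r ler_pdivrMr; [nra|lra].
  rewrite -[X in expR X]opprK expRN lef_pV2 ?posrE ?expR_gt0//; last by lra.
  exact: expR_ge1Dx.
have e2 : Num.sqrt (m%:R / (2 * pi * k%:R * (m - k)%:R)) <=
    (1 + s^-1) / (Num.sqrt (2 * pi) * s).
  have B0 : 0 <= (1 + s^-1) / (Num.sqrt (2 * pi) * s).
    by rewrite divr_ge0 ?mulr_ge0 ?sqrtr_ge0 ?addr_ge0 ?invr_ge0//; lra.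
  rewrite -[leRHS]ger0_norm// -sqrtr_sqr ler_wsqrtr//.
  rewrite expr_div_n exprMn sqr_sqrtr ?mulr_ge0 ?pi_ge0//.
  have s0 : 0 < s by lra.
  have fE (a : R) : 0 < a ->
      (1 + s^-1) ^+ 2 / (2 * a * s ^+ 2) = (s + 1) ^+ 2 / (2 * a * s ^+ 4).
    by move=> a0; field; rewrite !gt_eqF.
  rewrite fE//.
  apply: (@le_trans _ _ (2 * pi * (s ^+ 2 - 1))^-1).
    rewrite -[leRHS]mul1r ler_pdivlMr ?mulr_gt0//; last by lra.
    rewrite mulrAC ler_pdivrMr ?mulr_gt0// mul1r.
    have -> : m%:R * (2 * pi * (s ^+ 2 - 1)) = 2 * pi * (m%:R * (s ^+ 2 - 1)) by ring.
    by rewrite -[leRHS]mulrA ler_wpM2l// mulr_ge0// ltW.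
  rewrite -[leLHS]mul1r ler_pdivrMr ?mulr_gt0//; last by lra.
  rewrite mulrAC ler_pdivlMr ?mulr_gt0 ?exprn_gt0// mul1r.
  have -> : (s + 1) ^+ 2 * (2 * pi * (s ^+ 2 - 1)) =
    2 * pi * ((s + 1) ^+ 2 * (s ^+ 2 - 1)) by ring.
  rewrite ler_wpM2l ?mulr_ge0 ?pi_ge0// -subr_ge0.
  have -> : (s + 1) ^+ 2 * (s ^+ 2 - 1) - s ^+ 4 = 2 * s * (s ^+ 2 - 1) - 1 by ring.
  nra.
apply: le_trans (ler_pM _ _ e1 e2) _; rewrite ?expR_ge0 ?sqrtr_ge0//.
rewrite mulrA ler_wpM2r ?invr_ge0 ?mulr_ge0 ?sqrtr_ge0//.
set u := s^-1.
have -> : (4 * s ^+ 2)^-1 = u ^+ 2 / 4 by rewrite /u; field; rewrite gt_eqF//; lra.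
have u0 : 0 < u by rewrite invr_gt0; lra.
have u1 : u <= 1 by rewrite invf_le1; lra.
nra.
Qed.

(** In the application t = dp is the distance from the mean (n - d)p to the threshold np, and the 1
    absorbs rounding up. *)
Lemma binomial_tail_ge m p t r : (0 < m)%N -> 0 < p < 1 -> 0 <= t ->
  r%:R <= m%:R * p + t + 1 ->
  1 / 2 - t / Num.sqrt (2 * pi * m%:R * p * (1 - p))
    - 6 * (1 - 2 * p * (1 - p)) / Num.sqrt (m%:R * p * (1 - p))
  <= binomial_tail m p r.
Proof.
move=> m0 p01 t0 rle; have [p0 p1] := andP p01.
have p01' : 0 <= p <= 1 by rewrite !ltW.
have pi2 := @pi_ge2 R; have q0 : 0 < 1 - p by lra.
have mR : 0 < m%:R :> R by rewrite ltr0n.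
set s := Num.sqrt (m%:R * p * (1 - p)).
have s0 : 0 < s by rewrite sqrtr_gt0 !mulr_gt0.
have -> : Num.sqrt (2 * pi * m%:R * p * (1 - p)) = Num.sqrt (2 * pi) * s.
  by rewrite -sqrtrM ?mulr_ge0 ?(le_trans _ pi2)// !mulrA.
set S := Num.sqrt (2 * pi).
have S2 : 2 <= S.
  have -> : 2 = Num.sqrt (2 ^+ 2) :> R by rewrite sqrtr_sqr ger0_norm.
  by rewrite ler_sqrt ?expr2; lra.
(* Since pq <= 1/4, the factor 1 - 2pq is at least 1/2, so the constant 6 leaves an error budget of
   3/s. *)
have h : 3 / s <= 6 * (1 - 2 * p * (1 - p)) / s.
  rewrite ler_pM2r ?invr_gt0//.
  have : 0 <= (2 * p - 1) ^+ 2 by exact: sqr_ge0.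
  nra.
have tail0 := binomial_tail_ge0 m r p01'.
(* For s < 2, and then for 2t >= S s, the claimed bound is nonpositive. *)
have [s2|s2] := ltP s 2.
  have : 1 / 2 <= 3 / s by rewrite ler_pdivlMr//; lra.
  have : 0 <= t / (S * s) by rewrite divr_ge0// mulr_ge0 ?sqrtr_ge0// ltW.
  lra.
have [tS|tS] := leP (S * s) (2 * t).
  have : 1 / 2 <= t / (S * s) by rewrite ler_pdivlMr ?mulr_gt0//; lra.
  have : 0 <= 3 / s by rewrite divr_ge0// ltW.
  lra.
set B := (1 + 2 / s) / (S * s).
have /andP[] := truncn_itv (ltW (mulr_gt0 mR p0)).
have := binomial_tail_truncn m p01; set f := Num.truncn _ => half fle flt.
have B0 : 0 <= B by rewrite divr_ge0 ?mulr_ge0 ?addr_ge0 ?divr_ge0 ?ltW//; lra.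
(* Both f and f + 1 are within 1 of the mean, and the atoms do not increase beyond it. *)
have pmfB i : (f <= i)%N -> binomial_pmf m p i <= B.
  move=> /subnKC <-; elim: (i - f)%N => [|[|j] IH].
  - by rewrite addn0; apply: binomial_pmf_le_near_mean => //; rewrite -natr1 in flt; lra.
  - by rewrite addn1; apply: binomial_pmf_le_near_mean => //; rewrite -natr1 in flt *; lra.
  - rewrite addnS; apply: le_trans IH; apply: binomial_pmf_nincr => //.
    by apply: (le_trans (ltW flt)); rewrite ler_nat addnS ltnS leq_addr.
have tailB j : binomial_tail m p f <= binomial_tail m p (f + j) + j%:R * B.
  elim: j => [|j IH]; first by rewrite addn0 mul0r addr0.
  apply: (le_trans IH); rewrite binomial_tail_recl addnS -natr1.
  by have := pmfB (f + j)%N (leq_addr _ _); lra.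
(* Fewer than t + 2 integers lie in [f, r), because mp < f + 1. *)
have half' : 2^-1 <= binomial_tail m p r + (t + 2) * B.
  have [rf|fr] := leqP r f.
    have : binomial_tail m p f <= binomial_tail m p r.
      move: rf => /subnKC <-; elim: (f - r)%N => [|j IH]; first by rewrite addn0.
      by rewrite addnS (le_trans (binomial_tail_nincr _ _ p01')).
    have : 0 <= (t + 2) * B by rewrite mulr_ge0//; lra.
    lra.
  have := tailB (r - f)%N; rewrite subnKC ?(ltnW fr)//.
  have : (r - f)%:R * B <= (t + 2) * B.
    by rewrite ler_wpM2r// natrB ?(ltnW fr)//; rewrite -natr1 in flt; lra.
  lra.
(* Beyond t/(S s) there remains (2 + (4 + 2t)/s)/(S s); from s >= 2 and 2t < S s the numerator is at
   most 4 + S <= 3 S. *)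
suff : (t + 2) * B <= t / (S * s) + 3 / s by lra.
have -> : (t + 2) * B = t / (S * s) + (2 + (4 + 2 * t) / s) / (S * s).
  by rewrite /B; field; rewrite !gt_eqF//; lra.
rewrite lerD2l invfM mulrA ler_pM2r ?invr_gt0//.
have Sp : 0 < S by lra.
rewrite ler_pdivrMr//.
have : (4 + 2 * t) / s <= 2 + S.
  by rewrite ler_pdivrMr//; nra.
lra.
Qed.

End binomial_lower_tail.

(** * Expected loss of a bipartite graph *)

Lemma exists_natceil (R : archiRealFieldType) (x : R) : 0 <= x ->
  exists r : nat, forall k, (r <= k)%N = (x <= k%:R).
Proof.
move=> x0; have ex : exists k : nat, x <= k%:R by exists (Num.bound x); rewrite ltW// archi_boundP.
case: (ex_minnP ex) => r xr rmin; exists r => k; apply/idP/idP; last exact: rmin.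
by move=> rk; apply: (le_trans xr); rewrite ler_nat.
Qed.

Lemma binomial_prob_tail (R : realType) m (p : R) (x : R) r : 0 <= p <= 1 ->
  (forall k, (r <= k)%N = (x <= k%:R)) ->
  binomial_prob m p [set k | x <= k%:R] = (binomial_tail m p r)%:E.
Proof.
move=> /andP[p0 p1] rE; rewrite (@binomial_probE R m p p0 p1).
rewrite /binomial_tail -sumEFin big_geq_mkord.
rewrite [RHS]big_mkcond /=; apply: eq_bigr => k _; rewrite diracE rE.
by case: (boolP (_ <= _)) => xk; [rewrite mem_set// mule1|
  rewrite memNset ?mule0//= => xk'; rewrite xk' in xk].
Qed.

(** Increments are nondecreasing, so the line through d and d + 1 supports the sequence; one
    induction runs right from d, the other left. *)
Lemma convex_seq_ge (R : realDomainType) (h : nat -> R) (n d : nat) : (d < n)%N ->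
  (forall x, (x.+2 <= n)%N -> h x.+1 - h x <= h x.+2 - h x.+1) ->
  forall x, (x <= n)%N -> h d + (x%:R - d%:R) * (h d.+1 - h d) <= h x.
Proof.
move=> dn conv.
have slope x y : (x <= y)%N -> (y.+1 <= n)%N -> h x.+1 - h x <= h y.+1 - h y.
  move=> /subnKC <-; elim: (y - x)%N => [|j IH]; first by rewrite addn0.
  rewrite addnS => jn; apply: le_trans (conv _ jn).
  by apply: IH; exact: ltnW.
move=> x; have [/subnKC <-|/ltnW /subnKC] := leqP d x.
  elim: (x - d)%N => [|j IH] jn; first by rewrite addn0 subrr mul0r addr0.
  have := slope d (d + j)%N (leq_addr _ _); rewrite -addnS => /(_ jn).
  rewrite addnS in jn *; have := IH (ltnW jn); rewrite -natr1; lra.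
move=> + _; move: (d - x)%N => i; elim: i x => [|i IH] x xd.
  by rewrite -xd addn0 subrr mul0r addr0.
have := IH x.+1; rewrite addSnnS => /(_ xd).
have := slope x d; rewrite -{1}xd leq_addr => /(_ isT dn).
rewrite -natr1; lra.
Qed.

(** [h x] is the probability that x given demand nodes are zero and at least r of the others are
    not. Expanding by [binomial_tailS], its second difference is q^x p^2 times a tail. *)
Lemma scaled_tail_convex (R : realType) n (p : R) r
    (h := fun x => (1 - p) ^+ x * binomial_tail (n - x) p r) x :
  0 <= p <= 1 -> (x.+2 <= n)%N -> h x.+1 - h x <= h x.+2 - h x.+1.
Proof.
move=> p01 xn; rewrite /h; set q := 1 - p.
have -> : (n - x = (n - x.+2).+2)%N by lia.
have -> : (n - x.+1 = (n - x.+2).+1)%N by lia.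
set N := (n - x.+2)%N; have /andP[p0 p1] := p01.
rewrite !binomial_tailS.
rewrite -/q.
have qx : 0 <= q ^+ x by rewrite exprn_ge0// subr_ge0.
rewrite !exprS -subr_ge0.
set T0 := binomial_tail N p r; set T1 := binomial_tail N p r.-1.
set T2 := binomial_tail N p r.-1.-1.
have -> : q * (q * q ^+ x) * T0 - q * q ^+ x * (p * T1 + q * T0) -
    (q * q ^+ x * (p * T1 + q * T0) - q ^+ x * (p * (p * T2 + q * T1) + q * (p * T1 + q * T0)))
  = q ^+ x * p * p * T2 by ring.
by rewrite !mulr_ge0// binomial_tail_ge0.
Qed.

(** * Flows and the loss for a fixed demand *)

Section flow.
Context {R : realType} {n : nat}.
Implicit Types (G : bigraph n) (D : 'I_n -> R) (x : 'I_n -> 'I_n -> R) (p : R) (S : {set 'I_n}).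

Definition supply_nbrs G (i : 'I_n) : {set 'I_n} := [set j | (i, j) \in G]%SET.

Lemma flow_valueE G x :
  flow_value G x = \sum_i \sum_(j | (i, j) \in G) x i j.
Proof.
rewrite /flow_value pair_big_dep /=.
by apply: eq_bigl => -[i j].
Qed.

Lemma sum_supply_degree G : (\sum_i #|supply_nbrs G i| = #|G|)%N.
Proof.
rewrite -sum1_card (eq_bigl (fun e => (e.1, e.2) \in G)); last by case.
rewrite -(pair_big_dep xpredT (fun i j => (i, j) \in G) (fun _ _ => 1%N)) /=.
by apply: eq_bigr => i _; rewrite sum1_card cardsE.
Qed.

Lemma flow_value_le G D x : feasible_flow G D x -> flow_value G x <= n%:R.
Proof.
move=> [_ x1 _]; rewrite flow_valueE (le_trans (ler_sum _ (fun i _ => x1 i)))//.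
by rewrite sumr_const card_ord.
Qed.

Lemma flow_value_le_max G D x :
  feasible_flow G D x -> flow_value G x <= max_fulfilled G D.
Proof.
move=> xG; apply: ub_le_sup; last by exists x.
by exists n%:R => _ [y yG <-]; exact: flow_value_le yG.
Qed.

Lemma max_fulfilled_le G D (B : R) : (forall j, 0 <= D j) ->
  (forall x, feasible_flow G D x -> flow_value G x <= B) ->
  max_fulfilled G D <= B.
Proof.
move=> D0 xB; apply: ge_sup; last by move=> _ [y yG <-]; exact: xB.
exists (flow_value G (fun _ _ => 0)), (fun _ _ => 0) => //.
by split=> [//|i|j]; rewrite big1.
Qed.

Lemma loss_ge0 G D : (forall j, 0 <= D j) -> 0 <= loss G D.
Proof.
move=> D0; rewrite subr_ge0; apply: max_fulfilled_le => // x [x0 x1 xD].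
(* Entries of x off G are unconstrained, so they are reset to 0 before passing to the complete
   graph. *)
pose y i j := if (i, j) \in G then x i j else 0.
have <- : flow_value (complete_bigraph n) y = flow_value G x.
  rewrite !flow_valueE; apply: eq_bigr => i _.
  by rewrite [RHS]big_mkcond; apply: eq_bigl => j; rewrite inE.
apply: flow_value_le_max; split=> [i j _|i|j].
- by rewrite /y; case: ifP => // /x0.
- rewrite (eq_bigl xpredT) => [|j]; last by rewrite inE.
  by rewrite /y -big_mkcond x1.
- rewrite (eq_bigl xpredT) => [|i]; last by rewrite inE.
  by rewrite /y -(big_mkcond (fun i => (i, j) \in G)) xD.
Qed.

Definition bernoulli_demand (p : R) (S : {set 'I_n}) (j : 'I_n) : R :=
  if j \in S then p^-1 else 0.

Definition starved_supply G (S : {set 'I_n}) : {set 'I_n} :=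
  [set i | [disjoint supply_nbrs G i & S]]%SET.

Lemma bernoulli_demand_ge0 p S j : 0 < p -> 0 <= bernoulli_demand p S j.
Proof. by move=> p0; rewrite /bernoulli_demand; case: ifP; rewrite // invr_ge0 ltW. Qed.

(** Edges at a starved supply node end at zero demand and carry nothing; any other supply node ships
    at most 1. *)
Lemma max_fulfilled_bernoulli_le G p S : 0 < p ->
  max_fulfilled G (bernoulli_demand p S) <= n%:R - #|starved_supply G S|%:R.
Proof.
move=> p0; apply: max_fulfilled_le => [j|x [x0 x1 xD]].
  exact: bernoulli_demand_ge0.
have xS i j : (i, j) \in G -> j \notin S -> x i j = 0.
  move=> ij jS; apply/eqP; rewrite eq_le x0// andbT.
  have := xD j; rewrite /bernoulli_demand (negbTE jS) (bigD1 i)//=.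
  by apply: le_trans; rewrite lerDl sumr_ge0// => k /andP[/x0].
rewrite flow_valueE.
apply: (@le_trans _ _ (\sum_i (i \notin starved_supply G S)%:R)).
  apply: ler_sum => i _; case: (boolP (i \in _)) => [|_]; last exact: x1.
  rewrite inE => dis; rewrite big1// => j ij; apply: xS => //.
  by rewrite (disjointFr dis)// inE.
rewrite (eq_bigr (fun i => 1 - (i \in starved_supply G S)%:R)) => [|i _]; last first.
  by case: (i \in _); rewrite ?subrr ?subr0.
rewrite sumrB sumr_const card_ord -natr_sum.
suff -> : (\sum_i (i \in starved_supply G S) = #|starved_supply G S|)%N by [].
by rewrite -sum1_card [RHS]big_mkcond; apply: eq_bigr => i _; case: ifP.
Qed.

Lemma max_fulfilled_complete_ge p S : (0 < n)%N -> 0 < p -> n%:R * p <= #|S|%:R ->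
  n%:R <= max_fulfilled (complete_bigraph n) (bernoulli_demand p S).
Proof.
move=> n0 p0 npS.
have nR : 0 < n%:R :> R by rewrite ltr0n.
have S0 : 0 < #|S|%:R :> R by rewrite (lt_le_trans _ npS)// mulr_gt0.
(* Each supply node spreads one unit evenly over S, so a node of S receives n/#|S| <= 1/p. *)
pose x (i j : 'I_n) : R := if j \in S then #|S|%:R^-1 else 0.
have row i : \sum_(j | (i, j) \in complete_bigraph n) x i j = 1.
  rewrite (eq_bigl xpredT) => [|j]; last by rewrite inE.
  by rewrite /x -big_mkcond sumr_const -[LHS]mulr_natr mulVf// gt_eqF.
have <- : flow_value (complete_bigraph n) x = n%:R.
  by rewrite flow_valueE (eq_bigr (fun _ => 1)) ?sumr_const ?card_ord// => i _; exact: row.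
apply: flow_value_le_max; split=> [i j _|i|j].
- by rewrite /x; case: ifP; rewrite // invr_ge0 ltW.
- by rewrite row.
- rewrite (eq_bigl xpredT) => [|i]; last by rewrite inE.
  rewrite sumr_const card_ord /x /bernoulli_demand; case: ifP => _; last by rewrite mul0rn.
  by rewrite -[leLHS]mulr_natl ler_pdivrMr// ler_pdivlMl// mulrC.
Qed.

Lemma loss_bernoulli_ge G p S : (0 < n)%N -> 0 < p -> n%:R * p <= #|S|%:R ->
  #|starved_supply G S|%:R <= loss G (bernoulli_demand p S).
Proof.
move=> n0 p0 npS; rewrite /loss.
have := max_fulfilled_bernoulli_le G S p0; have := max_fulfilled_complete_ge n0 p0 npS.
lra.
Qed.

End flow.

(** * Bounding an expectation from below on finitely many atoms *)

Section expectation.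
Import HBNNSimple.
Context d (T : measurableType d) (R : realType) (P : probability T R).

Lemma ge0_le_integralT (f g : T -> \bar R) : (forall x, (0 <= f x)%E) ->
  (forall x, (f x <= g x)%E) -> (\int[P]_x f x <= \int[P]_x g x)%E.
Proof.
move=> f0 fg; rewrite !ge0_integralTE// => [|x]; last exact: le_trans (fg x).
apply: le_ereal_sup => _ [h hf <-]; exists h => // x.
exact: le_trans (hf x) (fg x).
Qed.

(** The integral is a supremum over simple functions below f; each vanishes off N and so integrates
    to 0. *)
Lemma integral_eq0_conull (f : T -> \bar R) (N : set T) : measurable N -> P N = 0%E ->
  (forall x, (0 <= f x)%E) -> (forall x, ~ N x -> f x = 0%E) ->
  (\int[P]_x f x = 0)%E.
Proof.
move=> mN PN f0 fN; apply/eqP; rewrite eq_le integral_ge0// andbT.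
rewrite ge0_integralTE//; apply: ge_ereal_sup => _ [h hf <-].
have := @integral_nnsfun _ _ _ P setT measurableT h; rewrite patch_setT => <-.
rewrite (ge0_negligible_integral mN measurableT)//.
- rewrite integral0_eq// => x [_ Nx]; apply/eqP.
  rewrite eq_le !lee_fin fun_ge0 andbT.
  by have := hf x; rewrite fN.
- by apply/measurable_EFinP; exact: measurable_funP.
- by move=> x _; rewrite lee_fin fun_ge0.
Qed.

(* f need not be measurable: only its values on the atoms E i are known. *)
Lemma expectation_ge_atoms (I : finType) (E : I -> set T) (c : I -> R) (f : T -> R) :
  (forall i, measurable (E i)) ->
  (forall i j x, E i x -> E j x -> i = j) ->
  (\sum_i P (E i) = 1)%E ->
  (forall i, 0 <= c i) -> (forall i x, E i x -> c i <= f x) ->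
  (\sum_i (c i)%:E * P (E i) <= 'E_P[f])%E.
Proof.
move=> mE Einj PE1 c0 cf; rewrite expectation.unlock.
pose I_ := [set` index_enum I]; pose U := \bigcup_(i in I_) E i.
have UE x : U x <-> exists i, E i x.
  split=> [[i _ Eix]|[i Eix]]; first by exists i.
  by exists i => //; rewrite /I_ /= mem_index_enum.
have mU : measurable U by apply: fin_bigcup_measurable => //; exact: finite_seq.
have PU : P (~` U) = 0%E.
  rewrite probability_setC//.
  suff -> : P U = 1%E by rewrite subee.
  rewrite -PE1 measure_fin_bigcup//.
  - by rewrite -fsbig_seq// index_enum_uniq.
  - exact: finite_seq.
  - by apply/trivIsetP => i j _ _ ij; apply/seteqP; split=> // x [/Einj h /h /eqP];
      rewrite (negbTE ij).
rewrite integralE.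
have -> : (\int[P]_x (fun x => (f x)%:E)^\- x = 0)%E.
  apply: (@integral_eq0_conull _ (~` U)) => //; first exact: measurableC.
  move=> x /contrapT /UE[i Eix]; rewrite funenegE; apply/max_idPr.
  by rewrite leeNl oppe0 lee_fin (le_trans (c0 i))// cf.
rewrite sube0.
(* The bound is the integral of the step function equal to c_i on E_i, which lies below the positive
   part of f. *)
have gE : (\sum_i (c i)%:E * P (E i) = \int[P]_x (\sum_i (c i * \1_(E i) x)%:E))%E.
  rewrite ge0_integral_sum//.
  - apply: eq_bigr => i _; rewrite (integralZl_indic measurableT (fun=> E i))//.
      by rewrite integral_indic// setIT.
    by move=> ci; have := c0 i; rewrite leNgt ci.
  - by move=> i; apply/measurable_EFinP; apply: measurable_funM.
  - by move=> i x _; rewrite lee_fin mulr_ge0.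
rewrite gE; apply: ge0_le_integralT => x.
  by apply: sume_ge0 => i _; rewrite lee_fin mulr_ge0.
have [/UE[i Eix]|nUx] := pselect (U x); last first.
  rewrite big1 ?funepos_ge0// => i _; rewrite indicE memNset ?mulr0// => Eix.
  by apply: nUx; apply/UE; exists i.
rewrite (bigD1 i)//= big1 ?adde0 => [|j ji].
  by rewrite indicE mem_set// mulr1 funeposE le_max lee_fin cf.
rewrite indicE memNset ?mulr0// => Ejx.
by move: ji; rewrite (Einj _ _ _ Ejx Eix) eqxx.
Qed.

End expectation.

(** * Sums over the possible supports of the demand *)

Section subset_sum.
Context {R : realType} (p : R) (U : finType).
Let n := #|U|.

Lemma sum_subsets_card (A : {set U}) (F : nat -> R) :
  \sum_(S : {set U} | S \subset A) F #|S| =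
  \sum_(k < #|A|.+1) 'C(#|A|, k)%:R * F k.
Proof.
rewrite (partition_big (fun S : {set U} => inord #|S| : 'I_#|A|.+1) xpredT)//=.
apply: eq_bigr => k _.
rewrite -cards_draws mulr_natl -sumr_const.
apply: eq_big => [S|S /andP[SA /eqP <-]].
  rewrite inE; case: (boolP (S \subset A)) => //= SA.
  by rewrite -val_eqE /= inordK// ltnS subset_leq_card.
by rewrite inordK// ltnS subset_leq_card.
Qed.

(** S plays the set of nonzero demands: the zeros outside A give the power of 1 - p, and the number
    of nonzero demands inside A is binomial. *)
Lemma sum_subsets_tail (A : {set U}) r :
  \sum_(S : {set U} | S \subset A) (if (r <= #|S|)%N then
     p ^+ #|S| * (1 - p) ^+ (n - #|S|) else 0) =
  (1 - p) ^+ (n - #|A|) * binomial_tail #|A| p r.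
Proof.
rewrite (sum_subsets_card A (fun k => if (r <= k)%N then p ^+ k * (1 - p) ^+ (n - k) else 0)).
rewrite /binomial_tail big_geq_mkord mulr_sumr [RHS]big_mkcond /=.
apply: eq_bigr => k _; case: ifP => _; last by rewrite mulr0.
have An : (#|A| <= n)%N by exact: max_card.
have kA : (k <= #|A|)%N by rewrite -ltnS.
have -> : (n - k = (n - #|A|) + (#|A| - k))%N by lia.
by rewrite binomial_pmfE exprD; ring.
Qed.

End subset_sum.

(** * The expected loss as a sum over supply nodes *)

Section loss_lower_bound.
Context {R : realType} (n d : nat) (p : R) (G : bigraph n).
Context dT (T : measurableType dT) (P : probability T R) (D : 'I_n -> {RV P >-> R}).
Hypotheses (p01 : 0 < p < 1) (dn : (d < n)%N).
Hypotheses (Gd : avg_degree R G = d%:R) (Dp : scaled_bernoulli p D).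

Let p0 : 0 < p. Proof. by case/andP: p01. Qed.
Let p1 : p < 1. Proof. by case/andP: p01. Qed.
Let n0 : (0 < n)%N. Proof. exact: leq_ltn_trans dn. Qed.
Let p01' : 0 <= p <= 1. Proof. by rewrite !ltW. Qed.

(** The intersection over the full finite set has the shape that [mutually_independent] expects. *)
Let atom (S : {set 'I_n}) : set T :=
  \bigcap_(j in [set` [set: 'I_n]%SET]) (D j @^-1` [set bernoulli_demand p S j]).

Let atomE S w : atom S w -> (fun j => D j w) = bernoulli_demand p S.
Proof. by move=> Sw; apply/funext => j; apply: Sw; rewrite /= inE. Qed.

Let measurable_atom S : measurable (atom S).
Proof.
apply: fin_bigcap_measurable => [|j _]; first exact: finite_finset.
by rewrite -[X in measurable X]setTI; apply: measurable_funP.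
Qed.

Let prob_atom S : P (atom S) = (p ^+ #|S| * (1 - p) ^+ (n - #|S|))%:E.
Proof.
have [ind D1 D0] := Dp.
rewrite /atom (ind [set: 'I_n]%SET (fun j => [set bernoulli_demand p S j]))//.
have -> : (\prod_(j in [set: 'I_n]%SET) P (D j @^-1` [set bernoulli_demand p S j]) =
  \prod_(j : 'I_n) (if j \in S then p else 1 - p)%:E)%E.
  apply: eq_big => [j|j _]; first by rewrite inE.
  by rewrite /bernoulli_demand; case: ifP => _; [exact: D1|exact: D0].
rewrite prodEFin; congr (_%:E).
rewrite (bigID (mem S)) /= (eq_bigr (fun=> p)) => [|j ->//].
rewrite prodr_const [X in _ * X](eq_bigr (fun=> 1 - p)) => [|j /negbTE ->//].
rewrite -[X in _ = _ * _ ^+ X](_ : #|~: S| = _)%N; last first.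
  by rewrite cardsCs finset.setCK card_ord.
by rewrite -[X in _ = _ * X]prodr_const; congr (_ * _); apply: eq_bigl => j; rewrite inE.
Qed.

Lemma expected_loss_ge r : (forall k, (r <= k)%N = (n%:R * p <= k%:R)) ->
  ((n%:R * (1 - p) ^+ d * binomial_tail (n - d) p r)%:E <= expected_loss D G)%E.
Proof.
move=> rE.
pose w (S : {set 'I_n}) : R := p ^+ #|S| * (1 - p) ^+ (n - #|S|).
(* A lower bound for the loss on the atom of S, nontrivial once the total demand reaches n. *)
pose c (S : {set 'I_n}) : R :=
  if (r <= #|S|)%N then #|starved_supply G S|%:R else 0.
pose h x := (1 - p) ^+ x * binomial_tail (n - x) p r.
have sum_c : \sum_S c S * w S = \sum_i h #|supply_nbrs G i|.
  have -> : \sum_S c S * w S = \sum_(S : {set 'I_n}) \sum_(i | i \in starved_supply G S)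
      (if (r <= #|S|)%N then w S else 0).
    apply: eq_bigr => S _; rewrite sumr_const /c; case: ifP => _.
      by rewrite mulr_natl.
    by rewrite mul0r mul0rn.
  (* Node i is starved exactly when S lies in the complement of its neighbourhood, so the inner sum
     is a subset sum. *)
  rewrite (exchange_big_dep xpredT)//=; apply: eq_bigr => i _.
  have cA : #|~: supply_nbrs G i| = (n - #|supply_nbrs G i|)%N.
    by rewrite cardsCs finset.setCK card_ord.
  have := sum_subsets_tail p (~: supply_nbrs G i) r.
  rewrite card_ord cA subKn => [tailE|]; last by rewrite -[leqRHS]card_ord max_card.
  rewrite /h -tailE.
  apply: eq_bigl => S; rewrite inE disjoint_sym.
  by rewrite finset.disjoints_subset.
have sum_w : \sum_S w S = 1.
  have := sum_subsets_tail p [set: 'I_n]%SET 0.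
  rewrite binomial_tail0 cardsT subnn mul1r => <-; rewrite card_ord.
  by apply: eq_bigl => S; rewrite finset.subsetT.
have le1 : n%:R * h d <= \sum_i h #|supply_nbrs G i|.
  (* The supporting line at d is summed over i; the degrees average to d, so its linear part
     cancels. *)
  have hge i : h d + (#|supply_nbrs G i|%:R - d%:R) * (h d.+1 - h d) <=
      h #|supply_nbrs G i|.
    apply: (convex_seq_ge dn) => [x xn|]; first exact: scaled_tail_convex.
    by rewrite -[leqRHS]card_ord max_card.
  apply: le_trans (ler_sum _ (fun i _ => hge i)).
  rewrite big_split /= sumr_const card_ord -mulr_suml sumrB -natr_sum.
  rewrite sum_supply_degree sumr_const card_ord.
  have -> : #|G|%:R = d%:R *+ n :> R.
    by rewrite -[RHS]mulr_natr -Gd /avg_degree divfK// pnatr_eq0 -lt0n.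
  by rewrite subrr mul0r addr0 mulr_natl.
rewrite -mulrA -/(h d); apply: (@le_trans _ _ (\sum_S c S * w S)%:E).
  by rewrite lee_fin sum_c.
rewrite -sumEFin (eq_bigr (fun S => (c S)%:E * P (atom S))%E) => [|S _]; last first.
  by rewrite prob_atom.
apply: expectation_ge_atoms => //.
- move=> S S' x /atomE DS /atomE; rewrite DS => SS'; apply/finset.setP => j.
  have := congr1 (fun f => f j) SS'; rewrite /bernoulli_demand.
  have pV : p^-1 != 0 by rewrite invr_eq0 gt_eqF.
  by case: (j \in S); case: (j \in S') => // /eqP; rewrite ?(negbTE pV)// eq_sym (negbTE pV).
- by rewrite (eq_bigr (fun S => (w S)%:E)) ?sumEFin ?sum_w// => S _; exact: prob_atom.
- by move=> S; rewrite /c; case: ifP.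
- move=> S x /atomE DS; rewrite DS /c; case: ifP => rS.
    by apply: loss_bernoulli_ge => //; rewrite -rE.
  by apply: loss_ge0 => j; exact: bernoulli_demand_ge0.
Qed.

End loss_lower_bound.

(** * Assembly of the two inequalities *)

Theorem theorem3p1 (R : realType) :
  exists2 c : R, 0 < c &
  forall (n d : nat) (p q : R) (G : bigraph n)
    (dT : measure_display) (T : measurableType dT) (P : probability T R)
    (D : 'I_n -> {RV P >-> R}),
    0 < p < 1 -> q = 1 - p ->
    (d < n)%N -> avg_degree R G = d%:R ->
    scaled_bernoulli p D ->
    (binomial_prob (n - d) p [set k | (n%:R * p <= k%:R)%R] * (n%:R * q ^+ d)%:E
       <= expected_loss D G)%E
    /\
    (((1 / 2%:R - d%:R * p / Num.sqrt (2%:R * pi * (n - d)%:R * p * q)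
         - c * (1 - 2%:R * p * q) / Num.sqrt ((n - d)%:R * p * q))
       * (n%:R * q ^+ d))%:E
       <= binomial_prob (n - d) p [set k | (n%:R * p <= k%:R)%R]
            * (n%:R * q ^+ d)%:E)%E.
Proof.
exists 6 => // n d p q G dT T P D p01 qE dn Gd Dp.
have [p0 p1] := andP p01; have p01' : 0 <= p <= 1 by rewrite !ltW.
have n0 : 0 <= n%:R * p by rewrite mulr_ge0// ltW.
have [r rE] := exists_natceil n0.
rewrite (binomial_prob_tail _ p01' rE) qE.
have dnR : n%:R = (n - d)%:R + d%:R :> R by rewrite -natrD subnK// ltnW.
split.
  rewrite -EFinM mulrC; exact: expected_loss_ge.
rewrite -EFinM lee_fin ler_wpM2r ?mulr_ge0 ?exprn_ge0 ?subr_ge0 ?(ltW p1)//.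
apply: binomial_tail_ge; rewrite ?subn_gt0 ?mulr_ge0 ?(ltW p0)//.
(* The threshold r is least with r >= np, so for r > 0 one has r - 1 < np = (n - d)p + dp. *)
case: r rE => [|r] rE; first by rewrite addr_ge0// addr_ge0 ?mulr_ge0 ?(ltW p0).
have : (r%:R < n%:R * p) by rewrite ltNge -rE ltnn.
rewrite dnR -natr1; lra.
Qed.
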